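(* For $m,n_1,\dots,n_m\in\mathbf{N}$ and $\mathcal{X}\in\mathbf{T}(n_1,\dots,n_m)$, let $X_{(j)}$ be the mode-$j$ unfolding of $\mathcal{X}$, let $r_j$ be the matrix rank of $X_{(j)}$ for $j=1,\dots,m$, and define $r(\mathcal{X})=\max\{r_1,\dots,r_m\}$. Then the function $r:\mathbf{T}\to\mathbf{Z}_+$ is a proper, subadditive tensor rank function, but it is not strongly proper.
   Context: $\mathbf{Z}_+$ is the set of nonnegative integers and $\mathbf{N}$ the set of positive integers. For $m,n_1,\dots,n_m\in\mathbf{N}$, $\mathbf{T}(n_1,\dots,n_m)$ is the set of real $m$th order tensors $\mathcal{X}=(x_{i_1\cdots i_m})$ of dimension $n_1\times\cdots\times n_m$; $\mathbf{CT}(m,n)$ is the case $n_1=\cdots=n_m=n$; $\mathbf{T}$ is the set of all real tensors (all orders $m\ge1$, all dimensions). A tensor $\mathcal{X}\in\mathbf{T}(n_1,\dots,n_m)$ is rank-one if $\mathcal{X}=\mathbf{x}^{(1)}\circ\cdots\circ\mathbf{x}^{(m)}$ (outer product) with nonzero $\mathbf{x}^{(i)}\in\mathbb{R}^{n_i}$. The identity tensor $\mathcal{I}_{m,n}\in\mathbf{CT}(m,n)$ has entries $1$ when $i_1=\cdots=i_m$ and $0$ otherwise. A subtensor of $\mathcal{X}\in\mathbf{T}(n_1,\dots,n_m)$ is a tensor of the same order $m$ obtained by choosing nonempty index sets $T_l\subseteq\{1,\dots,n_l\}$, $l=1,\dots,m$, and restricting $\mathcal{X}$ to $T_1\times\cdots\times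 T_m$; it is an element of $\mathbf{T}(|T_1|,\dots,|T_m|)$. A function $r:\mathbf{T}\to\mathbf{Z}_+$ is a tensor rank function if: (1) $r(\mathcal{X})=0$ iff $\mathcal{X}$ is a zero tensor, and $r(\mathcal{X})=1$ iff $\mathcal{X}$ is a rank-one tensor; (2) $r(\mathcal{I}_{m,n})=n$ for all $m,n\in\mathbf{N}$ with $m\ge2$; (3) for $\mathcal{X}\in\mathbf{T}(n_1,n_2,1,\dots,1)$ (order at least $2$), $r(\mathcal{X})$ equals the matrix rank of the $n_1\times n_2$ matrix corresponding to $\mathcal{X}$; (4) $r(\alpha\mathcal{X})=r(\mathcal{X})$ for every tensor $\mathcal{X}$ and real $\alpha\ne0$; (5) $r(\mathcal{Y})=r(\mathcal{X})$ whenever $\mathcal{Y}$ is obtained from $\mathcal{X}$ by permuting its modes, i.e. $\sigma$ is a permutation of the $m$ coordinates, $\mathcal{Y}$ has dimensions $\sigma(n_1,\dots,n_m)$, and the entry of $\mathcal{Y}$ at position $\sigma(i_1,\dots,i_m)$ is $x_{i_1\cdots i_m}$; (6) $r(\mathcal{Y})\le r(\mathcal{X})$ whenever $\mathcal{Y}$ is a subtensor of $\mathcal{X}$. A tensor rank function $r$ is proper if $r(\mathcal{X})\le n$ for all $m,n\in\mathbf{N}$ and $\mathcal{X}\in\mathbf{CT}(m,n)$. It is subadditive if $r(\mathcal{X}+\mathcal{Y})\le r(\mathcal{X})+r(\mathcal{Y})$ for all $m,n_1,\dots,n_m\in\mathbf{N}$ and $\mathcal{X},\mathcal{Y}\in\mathbf{T}(n_1,\dots,n_m)$.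 It is strongly proper if $r(\mathcal{X})\le\mathrm{submax}\{n_1,\dots,n_m\}$ for all $m,n_1,\dots,n_m\in\mathbf{N}$ with $m\ge2$ and $\mathcal{X}\in\mathbf{T}(n_1,\dots,n_m)$, where $\mathrm{submax}$ of a list of $m\ge2$ numbers is its second largest value counted with multiplicity (e.g. $\mathrm{submax}\{3,2,2\}=2$, $\mathrm{submax}\{n,n,n\}=n$). Mode-$j$ unfolding: $X_{(j)}\in\mathbb{R}^{n_j\times(n_1\cdots n_{j-1}n_{j+1}\cdots n_m)}$ is the matrix whose rows are indexed by $i_j$, whose columns are indexed by $(i_1,\dots,i_{j-1},i_{j+1},\dots,i_m)$, and whose entries are $x_{i_1\cdots i_m}$ (for $m=1$ it is an $n_1\times1$ matrix). *)

(* Defs.v *)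
From HB Require Import structures.
From mathcomp Require Import all_boot all_order all_algebra all_fingroup.
From mathcomp Require Import reals.

Set Implicit Arguments.
Unset Strict Implicit.
Unset Printing Implicit Defensive.
Import GRing.Theory.
Local Open Scope ring_scope.

Definition midx m (n : 'I_m -> nat) := {dffun forall k : 'I_m, 'I_(n k)}.

(* Real tensors of order m and dimension n_0 x ... x n_(m-1), with 0-based
   indices. The type also exists when m = 0 or some n_k = 0; every definition
   that quantifies over tensors excludes these cases by hypothesis.
   R^o makes a *: X available, with X + Y and 0 pointwise. *)
Definition tensor (R : realType) m (n : 'I_m -> nat) := {ffun midx n -> R^o}.

Section Tensors.
Variable R : realType.

Definition pos_dims m (n : 'I_m -> nat) := (0 < m)%N /\ forall k, (0 < n k)%N.

Definition cubical (m n : nat) := fun _ : 'I_m => n.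

Arguments cubical : clear implicits.

Definition outer m (n : 'I_m -> nat) (x : forall k, 'cV[R]_(n k)) : tensor R n :=
  [ffun i : midx n => \prod_(k < m) x k (i k) 0].

Definition rank_one m (n : 'I_m -> nat) (X : tensor R n) :=
  exists2 x : forall k, 'cV[R]_(n k), (forall k, x k != 0) & X = outer x.

Definition id_tensor m n : tensor R (cubical m n) :=
  [ffun i : midx (cubical m n) => [forall k, forall l, i k == i l :> 'I_n]%:R].

Definition midx_perm m (n : 'I_m -> nat) (s : 'S_m) (i : midx n) :
    midx (fun k => n (s k)) :=
  finfun (fun k => i (s k)).

Definition mode_perm m (n : 'I_m -> nat) (s : 'S_m) (X : tensor R n)
    (Y : tensor R (fun k => n (s k))) :=
  forall i : midx n, Y (midx_perm s i) = X i.

(* enum_val lists the elements of T l : {set 'I_(n l)} in increasing order. *)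
Definition subtensor m (n : 'I_m -> nat) (X : tensor R n)
    (T : forall l, {set 'I_(n l)}) : tensor R (fun l => #|T l|) :=
  [ffun i : midx (fun l => #|T l|) =>
     X (finfun (fun l => enum_val (i l)) : midx n)].

Definition tensor_fun := forall m (n : 'I_m -> nat), tensor R n -> nat.

Record tensor_rank_function (r : tensor_fun) : Prop := TensorRankFunction {
  trf_eq0 : forall m (n : 'I_m -> nat) (X : tensor R n), pos_dims n ->
    r m n X = 0%N <-> X = 0;
  trf_eq1 : forall m (n : 'I_m -> nat) (X : tensor R n), pos_dims n ->
    r m n X = 1%N <-> rank_one X;
  trf_id : forall m n, (2 <= m)%N -> (0 < n)%N ->
    r m (cubical m n) (id_tensor m n) = n;
  (* The last hypothesis determines A: the modes k >= 2 have a single index. *)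
  trf_matrix : forall m (n : 'I_m.+2 -> nat) (X : tensor R n)
      (A : 'M[R]_(n ord0, n (lift ord0 ord0))),
    pos_dims n -> (forall k : 'I_m.+2, (2 <= k)%N -> n k = 1%N) ->
    (forall i : midx n, A (i ord0) (i (lift ord0 ord0)) = X i) ->
    r m.+2 n X = \rank A;
  trf_scale : forall m (n : 'I_m -> nat) (X : tensor R n) (a : R), pos_dims n ->
    a != 0 -> r m n (a *: X) = r m n X;
  trf_perm : forall m (n : 'I_m -> nat) (s : 'S_m) (X : tensor R n)
      (Y : tensor R (fun k => n (s k))), pos_dims n ->
    mode_perm X Y -> r m (fun k => n (s k)) Y = r m n X;
  trf_sub : forall m (n : 'I_m -> nat) (X : tensor R n)
      (T : forall l, {set 'I_(n l)}), pos_dims n ->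
    (forall l, T l != set0) ->
    (r m (fun l => #|T l|) (subtensor X T) <= r m n X)%N
}.

Definition proper_rank (r : tensor_fun) := forall m n (X : tensor R (cubical m n)),
  (0 < m)%N -> (0 < n)%N -> (r m (cubical m n) X <= n)%N.

Definition subadditive_rank (r : tensor_fun) :=
  forall m (n : 'I_m -> nat) (X Y : tensor R n), pos_dims n ->
  (r m n (X + Y)%R <= r m n X + r m n Y)%N.

Definition submax m (n : 'I_m -> nat) : nat :=
  nth 0%N (sort geq [seq n k | k : 'I_m]) 1.

Definition strongly_proper_rank (r : tensor_fun) :=
  forall m (n : 'I_m -> nat) (X : tensor R n), (2 <= m)%N -> pos_dims n ->
  (r m n X <= submax n)%N.

(* The multi-index with entry a in mode j and entries c, in order, in the
   remaining modes. *)
Definition midx_insert m (n : 'I_m -> nat) (j : 'I_m) (a : 'I_(n j))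
    (c : midx (fun k : 'I_m.-1 => n (lift j k))) : midx n :=
  finfun (fun k : 'I_m =>
    match unliftP j k with
    | UnliftSome k' e => cast_ord (congr1 n (esym e)) (c k')
    | UnliftNone e => cast_ord (congr1 n (esym e)) a
    end).

Definition unfolding m (n : 'I_m -> nat) (X : tensor R n) (j : 'I_m) :
    'M[R]_(n j, #|{: midx (fun k : 'I_m.-1 => n (lift j k))}|) :=
  \matrix_(a, c) X (midx_insert a (enum_val c)).

Definition max_unfolding_rank : tensor_fun :=
  fun m n X => \max_(j < m) \rank (unfolding X j).

End Tensors.

(* Main.v *)
Require Import Defs.
From mathcomp Require Import all_boot all_order all_algebra reals.
From mathcomp Require Import all_fingroup.

(** The mode-[j] unfolding of [X] has rank at most [r] exactly when [X] is a sum
    of [r] products of a function of [i j] by a function of the other indices.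
    The rank axioms can be read off such decompositions. For instance, if all
    unfoldings of [X] have rank at most 1 then
    [X i * X i' = X (i with i' j in mode j) * X (i' with i j in mode j)], so
    replacing one by one the entries of [i] by those of a fixed [i0] with
    [X i0 != 0] exhibits [X] as an outer product. The 4 x 2 x 2 tensor with
    entries [i0 = 2 i1 + i2] has mode-0 unfolding the 4 x 4 identity matrix up
    to column order, while submax(4, 2, 2) = 2. *)

Set Implicit Arguments.
Unset Strict Implicit.
Unset Printing Implicit Defensive.
Import GRing.Theory.
Local Open Scope ring_scope.

(** * Multi-indices that differ in one mode only *)

Section MultiIndices.
Variables (m : nat) (n : 'I_m -> nat).
Implicit Types i : midx n.

Definition agree_off (j : 'I_m) i i' := forall k, k != j -> i k = i' k.

Definition midx_rest (j : 'I_m) i : midx (fun k : 'I_m.-1 => n (lift j k)) :=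
  finfun (fun k => i (lift j k)).

Definition midx_upd (j : 'I_m) i (a : 'I_(n j)) : midx n :=
  finfun (dfwith (fun k => i k) a).

Lemma midx_upd_in (j : 'I_m) i (a : 'I_(n j)) : midx_upd i a j = a.
Proof. by rewrite ffunE dfwith_in. Qed.

Lemma midx_upd_out (j : 'I_m) i (a : 'I_(n j)) : agree_off j (midx_upd i a) i.
Proof. by move=> k kj; rewrite ffunE dfwith_out // eq_sym. Qed.

Lemma midx_insert_in (j : 'I_m) (a : 'I_(n j)) c : midx_insert a c j = a.
Proof.
rewrite ffunE; case: (unliftP j j) => [k e|e]; last exact/val_inj.
by case/eqP: (neq_lift j k).
Qed.

Lemma midx_insert_off (j : 'I_m) (a b : 'I_(n j)) c :
  agree_off j (midx_insert a c) (midx_insert b c).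
Proof. by move=> k kj; rewrite !ffunE; case: unliftP => // e; case/eqP: kj. Qed.

Lemma midx_insert_rest (j : 'I_m) i : midx_insert (i j) (midx_rest j i) = i.
Proof.
apply/ffunP => k; rewrite ffunE.
case: (unliftP j k) => [k' e|e]; subst k; apply: val_inj => //=.
by rewrite ffunE.
Qed.

Lemma eq_midx_rest (j : 'I_m) i i' :
  agree_off j i i' -> midx_rest j i = midx_rest j i'.
Proof.
by move=> ii'; apply/ffunP => k; rewrite !ffunE ii' // eq_sym neq_lift.
Qed.

End MultiIndices.

(** * Rank bounds from decompositions of an unfolding *)

Section UnfoldingRank.
Variable R : realType.

Lemma tensorE m (n : 'I_m -> nat) (X : tensor R n) j (i : midx n) :
  X i = unfolding X j (i j) (enum_rank (midx_rest j i)).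
Proof. by rewrite mxE enum_rankK midx_insert_rest. Qed.

(** A rank factorization of the unfolding. The column functions [v p] take whole multi-indices and
    merely ignore mode [j], which keeps the index type of the columns out of later arguments. *)
Lemma unfolding_decomp m (n : 'I_m -> nat) (X : tensor R n) (j : 'I_m)
    (r := \rank (unfolding X j)) :
  exists u : 'I_(n j) -> 'I_r -> R, exists2 v : 'I_r -> midx n -> R,
    forall p i i', agree_off j i i' -> v p i = v p i' &
    forall i, X i = \sum_p u (i j) p * v p i.
Proof.
exists (col_base (unfolding X j)).
exists (fun p i => row_base (unfolding X j) p (enum_rank (midx_rest j i))).
  by move=> p i i' /eq_midx_rest ->.
by move=> i; rewrite (tensorE X j) -[in LHS](mulmx_base (unfolding X j)) mxE.
Qed.

Lemma rank_unfolding_decomp m (n : 'I_m -> nat) (X : tensor R n) (j : 'I_m) r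
    (u : 'I_(n j) -> 'I_r -> R) (v : 'I_r -> midx n -> R) :
    (forall p i i', agree_off j i i' -> v p i = v p i') ->
    (forall i, X i = \sum_p u (i j) p * v p i) ->
  (\rank (unfolding X j) <= r)%N.
Proof.
(* To evaluate [v p] at a column, some entry must be put in mode [j]; this requires [0 < n j]. *)
move=> vP XE; have [nj0|nj0] := posnP (n j).
  by apply: leq_trans (rank_leq_row _) _; rewrite nj0.
pose U := \matrix_(a, p) u a p.
pose V := \matrix_(p < r, c < #|{: midx (fun k => n (lift j k))}|)
  v p (midx_insert (Ordinal nj0) (enum_val c)).
suff -> : unfolding X j = U *m V by apply: mulmx_max_rank.
apply/matrixP => a c; rewrite !mxE XE midx_insert_in.
by apply: eq_bigr => p _; rewrite !mxE; congr (_ * _); apply/vP/midx_insert_off.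
Qed.

(** Substituting [phi] into a decomposition of [X] gives one of [Y] with equally many terms, because
    [phi] keeps row and column indices separate. *)
Lemma rank_unfolding_reindex m m' (n : 'I_m -> nat) (n' : 'I_m' -> nat)
    (X : tensor R n) (Y : tensor R n') j j'
    (phi : midx n' -> midx n) (f : 'I_(n' j') -> 'I_(n j)) :
    (forall i, phi i j = f (i j')) ->
    (forall i i', agree_off j' i i' -> agree_off j (phi i) (phi i')) ->
    (forall i, Y i = X (phi i)) ->
  (\rank (unfolding Y j') <= \rank (unfolding X j))%N.
Proof.
move=> phij phiP YE; have [u [v vP XE]] := unfolding_decomp X j.
apply: (@rank_unfolding_decomp _ _ _ _ _ (fun a => u (f a)) (fun p i => v p (phi i))).
  by move=> p i i' /phiP; apply: vP.
by move=> i; rewrite YE XE phij.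
Qed.

(** The source of all lower bounds: [B] is cut out of the unfolding, since [a] alone selects the row
    of [phi a c] and [c] alone its column. *)
Lemma rank_unfolding_ge m (n : 'I_m -> nat) (X : tensor R n) (j : 'I_m) p q
    (B : 'M[R]_(p, q)) (phi : 'I_p -> 'I_q -> midx n) :
    (forall a c c', phi a c j = phi a c' j) ->
    (forall a a' c, agree_off j (phi a c) (phi a' c)) ->
    (forall a c, B a c = X (phi a c)) ->
  (\rank B <= \rank (unfolding X j))%N.
Proof.
case: p B phi => [|p] B phi phij phiP BE.
  by apply: leq_trans (rank_leq_row _) _.
case: q B phi phij phiP BE => [|q] B phi phij phiP BE.
  by apply: leq_trans (rank_leq_col _) _.
have [u [v vP XE]] := unfolding_decomp X j; set r := \rank _ in u v vP XE *.
suff -> : B = (\matrix_(a < p.+1, k < r) u (phi a ord0 j) k) *m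
              (\matrix_(k < r, c < q.+1) v k (phi ord0 c)) by apply: mulmx_max_rank.
apply/matrixP => a c; rewrite BE XE mxE.
by apply: eq_bigr => k _; rewrite !mxE (phij a c ord0) (vP _ _ _ (phiP a ord0 c)).
Qed.

(** * Zero tensors and rank-one tensors *)

Lemma rank_unfolding0 m (n : 'I_m -> nat) (j : 'I_m) :
  \rank (unfolding (0 : tensor R n) j) = 0%N.
Proof.
by apply/eqP; rewrite mxrank_eq0; apply/eqP/matrixP => a c; rewrite !mxE ffunE.
Qed.

Lemma tensor_eq0_rank m (n : 'I_m -> nat) (X : tensor R n) (j : 'I_m) :
  \rank (unfolding X j) = 0%N -> X = 0.
Proof.
move=> /eqP; rewrite mxrank_eq0 => /eqP X0.
by apply/ffunP => i; rewrite (tensorE X j) X0 mxE ffunE.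
Qed.

Lemma tensor_neq0P m (n : 'I_m -> nat) (X : tensor R n) :
  X != 0 -> exists i, X i != 0.
Proof.
move=> X0; apply/existsP; apply: contraNT X0 => /existsPn X0.
by apply/eqP/ffunP => i; rewrite ffunE; apply/eqP/negPn.
Qed.

Lemma rank_unfolding_outer m (n : 'I_m -> nat) (x : forall k, 'cV[R]_(n k)) j :
  (\rank (unfolding (outer x) j) <= 1)%N.
Proof.
apply: (@rank_unfolding_decomp _ _ _ _ _ (fun a _ => x j a 0)
  (fun _ i => \prod_(k | k != j) x k (i k) 0)).
  by move=> _ i i' ii'; apply: eq_bigr => k /ii' ->.
by move=> i; rewrite ffunE big_ord1 (bigD1 j).
Qed.

Lemma outer_neq0 m (n : 'I_m -> nat) (x : forall k, 'cV[R]_(n k)) :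
  (forall k, x k != 0) -> outer x != 0.
Proof.
move=> x0.
have xP k : {a | x k a 0 != 0}.
  apply: sigW; apply/existsP; apply: contraNT (x0 k) => /existsPn xk.
  by apply/eqP/matrixP => a b; rewrite ord1 mxE; apply/eqP/negPn.
apply/eqP => /ffunP /(_ (finfun (fun k => sval (xP k)))) /eqP.
rewrite !ffunE; apply/negP/prodf_neq0 => k _.
by rewrite ffunE; case: (xP k).
Qed.

(** This is the vanishing of the 2 x 2 minors: with a single term, both sides equal
    [u (i j) * u (i' j) * v i * v i'], as [v] ignores mode [j]. *)
Lemma rank1_exchange m (n : 'I_m -> nat) (X : tensor R n) j (i i' : midx n) :
    (\rank (unfolding X j) <= 1)%N ->
  X i * X i' = X (midx_upd i (i' j)) * X (midx_upd i' (i j)).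
Proof.
have [u [v vP XE]] := unfolding_decomp X j.
move: (\rank _) u v vP XE => [|[|//]] u v vP XE _; rewrite !XE.
  by rewrite !big_ord0 !mul0r.
rewrite !big_ord1 !midx_upd_in !(vP _ _ _ (midx_upd_out _ _)).
by rewrite mulrACA (mulrC (u _ _) (u _ _)) mulrACA.
Qed.

Lemma rank1_rank_one m (n : 'I_m -> nat) (X : tensor R n) : (0 < m)%N -> X != 0 ->
  (forall j, \rank (unfolding X j) <= 1)%N -> rank_one X.
Proof.
move=> m0 /tensor_neq0P [i0 Xi0] rX.
(* The fibre of [X] through [i0] in mode [k], scaled to have entry 1 at [i0 k]. *)
pose w k (a : 'I_(n k)) : R := X (midx_upd i0 a) / X i0.
pose mix (s : seq 'I_m) (i : midx n) : midx n :=
  finfun (fun k => if k \in s then i0 k else i k).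
have XE s i : uniq s -> X i = X (mix s i) * \prod_(k <- s) w k (i k).
  elim: s => [_|j s IHs /= /andP[js us]].
    rewrite big_nil mulr1; congr (X _).
    by apply/ffunP => k; rewrite ffunE.
  rewrite IHs // big_cons mulrA; congr (_ * _).
  (* Exchange mode [j] between [mix s i] and [i0]; as [j] is not in [s], the entry given to [i0] is
     [i j]. *)
  apply: (mulIf Xi0); rewrite (rank1_exchange _ _ (rX j)) mulrA divfK //.
  rewrite ffunE (negbTE js); congr (X _ * _).
  apply/ffunP => k; rewrite [in RHS]ffunE inE.
  case: (eqVneq k j) => [->|kj]; first by rewrite midx_upd_in.
  by rewrite midx_upd_out // ffunE.
(* Taking all modes for [s] leaves the scalar factor [X i0], which is absorbed into the vector of
   the first mode. *)
pose c k : R := if k == Ordinal m0 then X i0 else 1.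
exists (fun k => \col_a (c k * w k a)) => [k|].
  apply/eqP => /matrixP /(_ (i0 k) 0); rewrite !mxE; apply/eqP/mulf_neq0.
    by rewrite /c; case: ifP; rewrite ?oner_eq0.
  suff i0E : midx_upd i0 (i0 k) = i0 by rewrite /w i0E divff ?oner_eq0.
  apply/ffunP => l; case: (eqVneq l k) => [->|lk]; first by rewrite midx_upd_in.
  by rewrite midx_upd_out.
apply/ffunP => i; rewrite ffunE (XE (index_enum 'I_m)) ?index_enum_uniq //.
under [RHS]eq_bigr do rewrite mxE.
rewrite [RHS]big_split /=; congr (_ * _).
rewrite /c -big_mkcond big_pred1_eq; congr (X _).
by apply/ffunP => k; rewrite ffunE mem_index_enum.
Qed.

(** * Permuted modes, subtensors, sums and multiples *)

Lemma rank_unfolding_perm m (n : 'I_m -> nat) (s : 'S_m) (X : tensor R n)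
    (Y : tensor R (fun k => n (s k))) (k : 'I_m) :
  mode_perm X Y -> \rank (unfolding Y k) = \rank (unfolding X (s k)).
Proof.
move=> XY; apply/eqP; rewrite eqn_leq; apply/andP; split; last first.
  apply: (@rank_unfolding_reindex _ _ _ _ _ _ _ _ (@midx_perm m n s) id) => //.
    by move=> i; rewrite ffunE.
  by move=> i i' ii' l lk; rewrite !ffunE ii' // (inj_eq perm_inj).
pose inv (i : midx (fun k => n (s k))) : midx n :=
  finfun (fun l => cast_ord (congr1 n (permKV s l)) (i ((s^-1)%g l))).
have invE i l : inv i (s l) = i l.
  (* The proof inside the cast is generalized first, so that its type can follow the rewriting of
     [(s^-1)%g (s l)] to [l]. *)
  rewrite ffunE; move: (permKV s (s l)).
  have -> : (s^-1)%g (s l) = l by rewrite permK.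
  by move=> e; apply: val_inj.
apply: (@rank_unfolding_reindex _ _ _ _ _ _ _ _ inv id) => //.
  move=> i i' ii' l lk; rewrite !ffunE ii' //.
  by apply: contraNneq lk => <-; rewrite permKV.
move=> i; rewrite -XY; congr (Y _).
by apply/ffunP => l; rewrite ffunE invE.
Qed.

Lemma rank_unfolding_sub m (n : 'I_m -> nat) (X : tensor R n)
    (T : forall l, {set 'I_(n l)}) (j : 'I_m) :
  (\rank (unfolding (subtensor X T) j) <= \rank (unfolding X j))%N.
Proof.
apply: (@rank_unfolding_reindex _ _ _ _ _ _ _ _
  (fun i => finfun (fun l => enum_val (i l)) : midx n) enum_val).
- by move=> i; rewrite ffunE.
- by move=> i i' ii' l lj; rewrite !ffunE ii'.
- by move=> i; rewrite ffunE.
Qed.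

Lemma rank_unfoldingD m (n : 'I_m -> nat) (X Y : tensor R n) (j : 'I_m) :
  (\rank (unfolding (X + Y)%R j) <=
   \rank (unfolding X j) + \rank (unfolding Y j))%N.
Proof.
have -> : unfolding (X + Y) j = unfolding X j + unfolding Y j.
  by apply/matrixP => a c; rewrite !mxE ffunE.
exact: mxrank_add.
Qed.

Lemma rank_unfoldingZ m (n : 'I_m -> nat) (X : tensor R n) (a : R) (j : 'I_m) :
  a != 0 -> \rank (unfolding (a *: X) j) = \rank (unfolding X j).
Proof.
move=> a0; have -> : unfolding (a *: X) j = a *: unfolding X j.
  by apply/matrixP => b c; rewrite !mxE ffunE.
exact: mxrank_scale_nz.
Qed.

(** * Identity tensors, matrices and the counterexample *)

Lemma rank_unfolding_id m n (j : 'I_m) : (2 <= m)%N -> (0 < n)%N ->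
  \rank (unfolding (id_tensor R m n) j) = n.
Proof.
case: m j => [|[|m]] // j _ n0.
apply/eqP; rewrite eqn_leq rank_leq_row /= -[leqLHS](mxrank1 R).
pose phi (a c : 'I_n) : midx (@cubical m.+2 n) :=
  finfun (fun k => if k == j then a else c).
apply: (@rank_unfolding_ge _ _ _ _ _ _ _ phi).
- by move=> a c c'; rewrite !ffunE eqxx.
- by move=> a a' c k kj; rewrite !ffunE (negbTE kj).
move=> a c; rewrite mxE ffunE; congr (_%:R); congr nat_of_bool.
apply/eqP/forallP => [-> k|].
  by apply/forallP => l; rewrite !ffunE !if_same.
(* A second mode, where the entry is [c], exists because the order is at least 2. *)
move=> /(_ j) /forallP /(_ (lift j ord0)).
by rewrite !ffunE eqxx (eq_sym (lift _ _)) (negbTE (neq_lift j ord0)) => /eqP.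
Qed.

(** Up to column order, the unfoldings in the first two modes are [A] and its transpose; every other
    one is a single row. *)
Lemma max_unfolding_rank_matrix m (n : 'I_m.+2 -> nat) (X : tensor R n)
    (A : 'M[R]_(n ord0, n (lift ord0 ord0))) :
    pos_dims n -> (forall k : 'I_m.+2, (2 <= k)%N -> n k = 1%N) ->
    (forall i : midx n, A (i ord0) (i (lift ord0 ord0)) = X i) ->
  max_unfolding_rank X = \rank A.
Proof.
move=> [_ n0] n1 AX; apply/eqP; rewrite eqn_leq; apply/andP; split; last first.
  apply: leq_trans (leq_bigmax (ord0 : 'I_m.+2)).
  pose i0 : midx n := finfun (fun k => Ordinal (n0 k)).
  pose phi (a : 'I_(n ord0)) (c : 'I_(n (lift ord0 ord0))) :=
    midx_upd (midx_upd i0 a) c.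
  have phi0 a c : phi a c ord0 = a by rewrite midx_upd_out // midx_upd_in.
  apply: (@rank_unfolding_ge _ _ _ _ _ _ _ phi).
  - by move=> a c c'; rewrite !phi0.
  - move=> a a' c k k0; case: (eqVneq k (lift ord0 ord0)) => [->|k1].
      by rewrite !midx_upd_in.
    by rewrite !midx_upd_out.
  - by move=> a c; rewrite -AX phi0 midx_upd_in.
have XE i : X i = \sum_p col_base A (i ord0) p * row_base A p (i (lift ord0 ord0)).
  by rewrite -AX -[in LHS](mulmx_base A) mxE.
apply/bigmax_leqP => j _; have [j2|] := leqP 2 j.
  (* A single row has rank at most 1, which suffices unless [A] is zero; then [X] is zero too. *)
  have [A0|A0] := posnP (\rank A); last first.
    by apply: leq_trans (rank_leq_row _) _; rewrite n1.
  suff -> : X = 0 by rewrite rank_unfolding0.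
  move/eqP: A0; rewrite mxrank_eq0 => /eqP A0.
  by apply/ffunP => i; rewrite -AX A0 mxE ffunE.
case: (unliftP ord0 j) => [j' ->|-> _].
  rewrite /= /bump /= add1n !ltnS leqn0 => j'0.
  have -> : j' = ord0 by apply/val_inj/eqP.
  apply: (@rank_unfolding_decomp _ _ _ _ _ (fun a p => row_base A p a)
    (fun p i => col_base A (i ord0) p)) => [p i i' -> //|i].
  by rewrite XE; apply: eq_bigr => p _; rewrite mulrC.
by apply: (@rank_unfolding_decomp _ _ _ _ _ (col_base A)
  (fun p i => row_base A p (i (lift ord0 ord0)))) => [p i i' -> //|i].
Qed.

Lemma max_unfolding_rank_not_strongly_proper :
  ~ strongly_proper_rank (@max_unfolding_rank R).
Proof.
(* Dimensions 4, 2, 2, written as successors so that positivity holds by computation and [inord]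
   applies. *)
pose n (k : 'I_3) := (if k == ord0 then 3 else 1).+1.
pose X : tensor R n :=
  [ffun i : midx n => (i ord0 == 2 * i (lift ord0 ord0) + i ord_max :> nat)%N%:R].
move=> /(_ 3 n X isT (conj isT (fun=> isT))).
have -> : submax n = 2.
  by rewrite /submax /image_mem !enum_ordSl enum_ord0.
apply/negP; rewrite -ltnNge; apply: leq_trans (leq_bigmax (ord0 : 'I_3)).
apply: (@leq_trans 4) => //; rewrite -[leqLHS](mxrank1 R).
(* Column [c] of the identity matrix is placed at the two binary digits of [c]. *)
pose phi (a c : 'I_4) : midx n := finfun (fun k =>
  inord (if k == ord0 then a : nat else if k == lift ord0 ord0 then c %/ 2 else c %% 2)%N).
apply: (@rank_unfolding_ge _ _ _ _ _ _ _ phi).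
- by move=> a c c'; rewrite !ffunE.
- by move=> a a' c k k0; rewrite !ffunE; congr inord; rewrite (negbTE k0).
move=> a c; rewrite mxE !ffunE.
by rewrite !inordK ?ltn_mod ?ltn_divLR //= mulnC -divn_eq.
Qed.

End UnfoldingRank.

Theorem theorem3p3 (R : realType) :
  [/\ tensor_rank_function (@max_unfolding_rank R),
      proper_rank (@max_unfolding_rank R),
      subadditive_rank (@max_unfolding_rank R)
    & ~ strongly_proper_rank (@max_unfolding_rank R)].
Proof.
have le_max m (n : 'I_m -> nat) (X : tensor R n) j :
  (\rank (unfolding X j) <= max_unfolding_rank X)%N by apply: leq_bigmax.
have eq0 m (n : 'I_m -> nat) (X : tensor R n) : (0 < m)%N ->
    max_unfolding_rank X = 0%N <-> X = 0.
  move=> m0; split=> [X0|->].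
    apply: (@tensor_eq0_rank _ _ _ _ (Ordinal m0)).
    by apply/eqP; rewrite -leqn0; apply: leq_trans (le_max _ _ _ _) (eq_leq X0).
  by apply: big1 => j _; apply: rank_unfolding0.
split; last exact: max_unfolding_rank_not_strongly_proper.
- split.
  + by move=> m n X [m0 _]; apply: eq0.
  + move=> m n X [m0 _]; split=> [X1|[x x0 ->]].
      apply: rank1_rank_one => // [|j]; last by rewrite -X1.
      by apply/eqP => /(eq0 _ _ _ m0); rewrite X1.
    apply/eqP; rewrite eqn_leq; apply/andP; split.
      by apply/bigmax_leqP => j _; apply: rank_unfolding_outer.
    rewrite lt0n; apply/eqP => /(eq0 _ _ _ m0) /eqP.
    exact/negP/outer_neq0.
  + move=> m n m2 n0; apply/eqP; rewrite eqn_leq; apply/andP; split.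
      by apply/bigmax_leqP => j _; apply: rank_leq_row.
    apply: leq_trans (le_max _ _ _ (Ordinal (ltnW m2))).
    by rewrite rank_unfolding_id.
  + exact: max_unfolding_rank_matrix.
  + by move=> m n X a _ a0; apply: eq_bigr => j _; apply: rank_unfoldingZ.
  (* Mode [k] of [Y] is mode [s k] of [X], so the two maxima run over the same ranks. *)
  + move=> m n s X Y _ XY; rewrite [RHS](reindex_inj (@perm_inj _ s)).
    by apply: eq_bigr => k _; apply: rank_unfolding_perm.
  + move=> m n X T _ _; apply/bigmax_leqP => j _.
    exact: leq_trans (rank_unfolding_sub X T j) (le_max _ _ _ _).
- by move=> m n X _ _; apply/bigmax_leqP => j _; apply: rank_leq_row.
- move=> m n X Y _; apply/bigmax_leqP => j _.
  by apply: leq_trans (rank_unfoldingD X Y j) _; rewrite leq_add.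
Qed.
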